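(* Let $G=(V,E)$ be a finite simple graph, $\lambda\in\mathbb{Z}_{>0}^V$, and $\Lambda:=\sum_{v\in V}\lambda_v$. Then for every positive integer $n$, \[ (-1)^{ |V| } q^\Lambda \, \widetilde{\chi}^\lambda_G \left( \tfrac 1q, [-n]_{\frac 1q} \right) \;=\; \sum_{(c,\rho)} q^{\sum_{v\in V} \lambda_v c(v)}, \] where the sum is over all pairs consisting of a (not necessarily proper) coloring $c:V\to\{1,\dots,n\}$ and an acyclic orientation $\rho$ of $G$ compatible with $c$.
   Context: $\chi_G^\lambda(q,n):=\sum_c q^{\sum_v\lambda_v c(v)}$ over proper colorings $c:V\to\{1,\dots,n\}$ ($c(v)\ne c(w)$ whenever $vw\in E$); $\widetilde{\chi}^\lambda_G(q,x)$ is the unique polynomial in $\mathbb{Q}(q)[x]$ with $\widetilde{\chi}^\lambda_G(q,[n]_q)=\chi_G^\lambda(q,n)$ for all positive integers $n$, where $[m]_q:=\frac{1-q^m}{1-q}$ for any integer $m$. Thus $\widetilde{\chi}^\lambda_G(\tfrac1q,x)$ is obtained by replacing $q$ by $1/q$ in the coefficients, and $[-n]_{1/q}=\frac{1-q^{n}}{1-q^{-1}}$. A coloring $c$ is compatible with an acyclic orientation $\rho$ if $c(u)\le c(w)$ for every edge oriented from $u$ to $w$ in $\rho$. *)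

(* Defs.v *)
From HB Require Import structures.
From mathcomp Require Import all_boot all_order all_algebra generic_quotient.
From mathcomp Require Import boolp classical_sets.

Set Implicit Arguments.
Unset Strict Implicit.
Unset Printing Implicit Defensive.

Import GRing.Theory.
Local Open Scope ring_scope.
Local Open Scope quotient_scope.

Notation Qq := {fraction {poly rat}}.

Definition tofracq : {poly rat} -> Qq := @FracField.tofrac {poly rat}.
HB.instance Definition _ := GRing.RMorphism.on tofracq.

Definition q : Qq := tofracq 'X.

Definition ratq : rat -> Qq := tofracq \o polyC.
HB.instance Definition _ := GRing.RMorphism.on ratq.

(* For m : int, "r ^ m" is the integer power of ssrint. *)
Definition qint (r : Qq) (m : int) : Qq := (1 - r ^ m) / (1 - r).

(* The substitution q |-> 1/q on Q(q), computed on the canonical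
   representative \n_(repr f) / \d_(repr f) of f; it does not depend on that
   choice and it is the automorphism of Q(q) over Q sending q to 1/q: see
   subst_qVE and subst_qV_q below. *)
Definition subst_qV (f : Qq) : Qq :=
  (map_poly ratq \n_(repr f)).[q^-1] / (map_poly ratq \d_(repr f)).[q^-1].

Section Graph.
Variables (T : finType) (e : rel T).

Definition proper_coloring (n : nat) (c : {ffun T -> 'I_n}) : bool :=
  [forall v, forall w, e v w ==> (c v != c w)].

(* The element i of 'I_n stands for the colour i + 1 of {1, ..., n}. *)
Definition color_weight (lam : T -> nat) (n : nat) (c : {ffun T -> 'I_n}) : nat :=
  (\sum_v lam v * (c v).+1)%N.

Definition chi (lam : T -> nat) (n : nat) : Qq :=
  \sum_(c : {ffun T -> 'I_n} | proper_coloring c) q ^+ color_weight lam c.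

Definition is_chi_tilde (lam : T -> nat) (p : {poly Qq}) : Prop :=
  forall n : nat, (0 < n)%N -> p.[qint q n%:Z] = chi lam n.

(* Definite description: the polynomial p such that is_chi_tilde lam p, unique
   by is_chi_tilde_inj below. The default value 0 is never used: for every
   finite simple graph and positive lam such a polynomial exists. *)
Definition chi_tilde (lam : T -> nat) : {poly Qq} :=
  xget 0 [set p | is_chi_tilde lam p]%classic.

(* An orientation is given by its set of arcs: (u, v) \in rho means that the
   edge uv is oriented from u to v. *)
Definition orientation (rho : {set T * T}) : bool :=
  [forall u, forall v,
    if e u v then ((u, v) \in rho) (+) ((v, u) \in rho) else (u, v) \notin rho].

Definition acyclic (rho : {set T * T}) : Prop :=
  forall s : seq T, s != [::] -> ~~ cycle (fun u v => (u, v) \in rho) s.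

Definition acyclic_orientation (rho : {set T * T}) : bool :=
  orientation rho && `[< acyclic rho >].

Definition compatible (n : nat) (c : {ffun T -> 'I_n}) (rho : {set T * T}) : bool :=
  [forall u, forall w, ((u, w) \in rho) ==> (c u <= c w)%N].

End Graph.

Lemma horner_ratq (p : {poly rat}) : (map_poly ratq p).[q] = tofracq p.
Proof.
elim/poly_ind: p => [|p c IH]; first by rewrite !rmorph0 horner0.
by rewrite !rmorphD !rmorphM /= map_polyX map_polyC !hornerE IH.
Qed.

Lemma horner_ratq_inv_neq0 (p : {poly rat}) :
  p != 0 -> (map_poly ratq p).[q^-1] != 0.
Proof.
move=> p0; apply/negP => r0.
have : algebraicOver ratq q^-1 by exists p.
move=> /algebraic_inv; rewrite invrK => -[s s0].
rewrite /root horner_ratq /tofracq tofrac_eq0 => /eqP s0'.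
by rewrite s0' eqxx in s0.
Qed.

Lemma subst_qVE (a b : {poly rat}) : b != 0 ->
  subst_qV (tofracq a / tofracq b) =
    (map_poly ratq a).[q^-1] / (map_poly ratq b).[q^-1].
Proof.
move=> b0; rewrite /subst_qV; set f := tofracq a / tofracq b.
have d0 : \d_(repr f) != 0 by exact: denom_ratioP.
have fE : f = \pi_Qq (Ratio a b).
  rewrite /f /tofracq; unlock FracField.tofrac.
  transitivity (FracField.mul (\pi_Qq (Ratio a 1))
                              (FracField.inv (\pi_Qq (Ratio b 1)))) => //.
  rewrite -FracField.pi_inv -FracField.pi_mul.
  rewrite /FracField.mulf /FracField.invf.
  by rewrite !numden_Ratio ?oner_eq0 // mulr1 mul1r.
have := FracField.equivf_l (Ratio a b); rewrite -fE !numden_Ratio // => E.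
apply/eqP; rewrite eqr_div ?horner_ratq_inv_neq0 //; apply/eqP.
by rewrite -!hornerM -!rmorphM /= E mulrC.
Qed.

Lemma subst_qV_q : subst_qV q = q^-1.
Proof.
have := @subst_qVE 'X 1 (oner_neq0 _); rewrite rmorph1 divr1 => ->.
by rewrite rmorph1 map_polyX !hornerE divr1.
Qed.

Lemma qint_inj (m n : nat) : qint q m%:Z = qint q n%:Z -> m = n.
Proof.
have q1 : 1 - q != 0.
  rewrite subr_eq0 -[1](rmorph1 tofracq) /q /tofracq tofrac_eq.
  apply/eqP => /(congr1 (fun p : {poly rat} => size p)).
  by rewrite size_polyX size_poly1.
move=> /(mulIf (invr_neq0 q1)) /addrI /oppr_inj.
rewrite -!exprnP /q -!rmorphXn /= => /eqP; rewrite /tofracq tofrac_eq => /eqP.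
by move=> /(congr1 (fun p : {poly rat} => size p)); rewrite !size_polyXn => -[].
Qed.

Lemma is_chi_tilde_inj (T : finType) (e : rel T) (lam : T -> nat)
    (p1 p2 : {poly Qq}) :
  is_chi_tilde e lam p1 -> is_chi_tilde e lam p2 -> p1 = p2.
Proof.
move=> h1 h2; apply/eqP; rewrite -subr_eq0; apply/eqP.
pose s := [seq qint q n.+1%:Z | n <- iota 0 (size (p1 - p2))].
apply: (@roots_geq_poly_eq0 _ _ s); last by rewrite size_map size_iota.
- by apply/allP => _ /mapP[n _ ->]; rewrite /root !hornerE h1 // h2 // subrr.
- by rewrite map_inj_uniq ?iota_uniq // => m n /qint_inj [].
Qed.

(* Main.v *)
(* Write [chi_W(n)] for the weighted count of proper colorings of the subgraph
   induced on [W], and [R_W(n)] for the weighted count of pairs (c, rho) on it.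
   Removing the color class [I] of color [n+1] gives
     chi_W(n+1) = sum_I q^((n+1) lam(I)) chi_{W-I}(n)
   over the independent sets [I] of [W], and inclusion-exclusion on the set of
   sinks of [rho] having color [n+1] (it is empty iff the color [n+1] is not
   used) gives
     R_W(n) = sum_I (-1)^|I| q^((n+1) lam(I)) R_{W-I}(n+1).
   By induction on [|W|] there is a polynomial [P] with [P(q^n) = chi_W(n)] whose
   image under q |-> 1/q takes the value [(-1)^|W| q^(-lam(W)) R_W(n)] at [q^n]:
   summing y^k over y = q, ..., q^n gives q^k (1 - q^(kn)) / (1 - q^k), and
   q |-> 1/q turns this polynomial in [q^n] into minus the sum of y^k over
   y = 1, ..., q^(n-1). Finally [x = [n]_q] is the affine change of variable
   [q^n = 1 - (1 - q) x]. *)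
Require Import Defs.
From HB Require Import structures.
From mathcomp Require Import all_boot all_order all_algebra generic_quotient.
From mathcomp Require Import boolp ring.
From mathcomp Require classical_sets.

Set Implicit Arguments.
Unset Strict Implicit.
Unset Printing Implicit Defensive.

Import GRing.Theory.
Local Open Scope ring_scope.

(** * The substitution q |-> 1/q as a ring morphism of Q(q) *)

Lemma Qq_fracE (f : Qq) :
  exists2 b : {poly rat}, b != 0 & exists a, f = tofracq a / tofracq b.
Proof.
rewrite -[f]reprK; case: (repr f) => -[a b] /= b0; exists b => //; exists a.
rewrite /tofracq; unlock FracField.tofrac.
transitivity (FracField.mul (\pi_Qq (Ratio a 1))
                            (FracField.inv (\pi_Qq (Ratio b 1))))%qT => //.
rewrite -FracField.pi_inv -FracField.pi_mul.
rewrite /FracField.mulf /FracField.invf.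
rewrite !numden_Ratio ?oner_eq0 // mulr1 mul1r.
by congr (\pi_Qq _)%qT; rewrite -[LHS]Ratio_numden.
Qed.

Section FractionMorphism.
Variables (R : idomainType) (F : fieldType) (f g : {rmorphism R -> F}).
Variable s : F -> F.
Hypotheses (f_neq0 : forall b, b != 0 -> f b != 0)
           (g_neq0 : forall b, b != 0 -> g b != 0)
           (fracE : forall x, exists2 b, b != 0 & exists a, x = f a / f b)
           (sE : forall a b, b != 0 -> s (f a / f b) = g a / g b).

(** [s] extends [g] to fractions, so additivity is read off the formula for the sum of two
    fractions, whose denominators stay nonzero under [f] and [g]. *)
Lemma fraction_zmod_morphism : zmod_morphism s.
Proof.
move=> x y; have [b b0 [a ->]] := fracE x; have [d d0 [c ->]] := fracE y.
rewrite -mulNr addf_div ?f_neq0 // mulNr -!rmorphM -rmorphB !sE ?mulf_neq0 //.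
by rewrite rmorphB !rmorphM -[in RHS]mulNr addf_div ?g_neq0 // mulNr.
Qed.

Lemma fraction_monoid_morphism : monoid_morphism s.
Proof.
split.
  by have := sE 1 (oner_neq0 _); rewrite !rmorph1 divr1.
move=> x y; have [b b0 [a ->]] := fracE x; have [d d0 [c ->]] := fracE y.
by rewrite mulf_div -!rmorphM !sE ?mulf_neq0 // !rmorphM mulf_div.
Qed.

End FractionMorphism.

Lemma tofracq_neq0 (b : {poly rat}) : b != 0 -> tofracq b != 0.
Proof. by rewrite /tofracq tofrac_eq0. Qed.

(** Evaluation at 1/q, packaged as a morphism whose extension to fractions is [subst_qV]. *)
Definition ratq_qV : {rmorphism {poly rat} -> Qq} :=
  horner_eval q^-1 \o map_poly ratq.

Lemma subst_qV_is_zmod_morphism : zmod_morphism subst_qV.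
Proof.
exact: (@fraction_zmod_morphism _ _ tofracq ratq_qV _ tofracq_neq0
  horner_ratq_inv_neq0 Qq_fracE subst_qVE).
Qed.

Lemma subst_qV_is_monoid_morphism : monoid_morphism subst_qV.
Proof.
exact: (@fraction_monoid_morphism _ _ tofracq ratq_qV _ Qq_fracE subst_qVE).
Qed.

HB.instance Definition _ :=
  GRing.isZmodMorphism.Build Qq Qq subst_qV subst_qV_is_zmod_morphism.
HB.instance Definition _ :=
  GRing.isMonoidMorphism.Build Qq Qq subst_qV subst_qV_is_monoid_morphism.

Lemma q_neq0 : q != 0.
Proof. by rewrite /q /tofracq tofrac_eq0 polyX_eq0. Qed.

(** [q] is not a root of unity, by comparing degrees in Q[X]. *)
Lemma q_expn_neq1 (n : nat) : (0 < n)%N -> 1 - q ^+ n != 0.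
Proof.
move=> n0; rewrite subr_eq0 eq_sym -[1](rmorph1 tofracq) /q -rmorphXn /=.
rewrite /tofracq tofrac_eq; apply/eqP => /(congr1 (fun p : {poly rat} => size p)).
by rewrite size_polyXn size_poly1 => -[] n0'; rewrite n0' in n0.
Qed.

(** * Summation of a polynomial along a geometric progression *)

Lemma geometric_sum (F : fieldType) (x : F) (n : nat) : 1 - x != 0 ->
  \sum_(m < n) x ^+ m = (1 - x ^+ n) / (1 - x).
Proof.
move=> x1; apply: (mulIf x1); rewrite divfK // -[1 - x]opprB mulrN mulrC.
by rewrite -subrX1 opprB.
Qed.

(** By linearity the monomials X^i are summed one at a time. Under [s] the factor t^i / (1 - t^i)
    becomes -1 / (1 - t^i), which produces the sign and moves the exponents from 1, ..., n to 0,
    ..., n-1. The condition on [h] discards i = 0, where 1 - t^i vanishes. *)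
Lemma sum_horner_expr (F : fieldType) (s : {rmorphism F -> F}) (t : F)
    (t0 : t != 0) (tX1 : forall n, (0 < n)%N -> 1 - t ^+ n != 0)
    (st : s t = t^-1) (h : {poly F}) : h.[0] = 0 ->
  exists P : {poly F}, forall n : nat,
    P.[t ^+ n] = \sum_(m < n) h.[t ^+ m.+1] /\
    (map_poly s P).[t ^+ n] = - \sum_(m < n) (map_poly s h).[t ^+ m].
Proof.
move=> h0; have {}h0 : h`_0 = 0 by rewrite -horner_coef0.
exists (\sum_(i < size h) (h`_i * (t ^+ i / (1 - t ^+ i))) *: (1 - 'X^i)) => n.
rewrite raddf_sum /= !horner_sum; split.
  under [RHS]eq_bigr do rewrite horner_coef.
  rewrite exchange_big; apply: eq_bigr => -[[|i] ltih] _ /=.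
    by rewrite h0 !mul0r scale0r horner0 big1 // => m _; rewrite mul0r.
  rewrite -mulr_sumr !hornerE -!mulrA; congr (_ * _).
  under eq_bigr do rewrite -exprM mulnC exprM exprS.
  rewrite -mulr_sumr geometric_sum ?tX1 //.
  by rewrite -![t ^+ _ ^+ _]exprM mulnC [_^-1 * _]mulrC.
rewrite -sumrN.
under [RHS]eq_bigr do rewrite horner_coef -sumrN size_map_poly.
rewrite exchange_big; apply: eq_bigr => -[[|i] ltih] _ /=.
  rewrite h0 !mul0r scale0r rmorph0 horner0 big1 // => m _.
  by rewrite coef_map /= h0 rmorph0 mul0r oppr0.
rewrite sumrN -mulr_sumr -mulrN coef_map map_polyZ rmorphB rmorph1 /= map_polyXn.
rewrite hornerZ rmorphM /= -mulrA; congr (_ * _); rewrite !hornerE.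
under eq_bigr do rewrite -exprM mulnC exprM.
rewrite geometric_sum ?tX1 // -[t ^+ n ^+ _]exprM mulnC exprM.
rewrite fmorph_div rmorphB rmorph1 rmorphXn /= st exprVn.
have := @tX1 i.+1 isT; have : t ^+ i.+1 != 0 by rewrite expf_neq0.
move: (t ^+ i.+1) => x x0 x1.
by rewrite -invfM [x * _]mulrBr mulr1 mulfV // -opprB invrN mulNr mulrC.
Qed.

(** * Inclusion-exclusion signs *)

Lemma sum_subset_sign (R : pzRingType) (T : finType) (M : {set T}) :
  \sum_(I : {set T} | I \subset M) (-1) ^+ #|I| = (M == set0)%:R :> R.
Proof.
have [->|/set0Pn[x xM]] := eqVneq M set0.
  under eq_bigl do rewrite subset0.
  by rewrite big_pred1_eq cards0.
(* Adding [x] pairs the subsets without [x] with those containing it, and reverses the sign. *)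
rewrite (bigID (fun I : {set T} => x \in I)) /=.
rewrite (reindex_onto (fun I => x |: I) (fun I => I :\ x)) /=; last first.
  by move=> I /andP[_ xI]; rewrite setD1K.
rewrite [X in X + _](_ : _ = - \sum_(I : {set T} | (I \subset M) && (x \notin I))
  (-1) ^+ #|I|) ?addNr // -sumrN.
apply: eq_big => [I|I].
  rewrite subUset sub1set xM setU11 andbT /=; congr (_ && _).
  apply/eqP/idP => [<-|xI]; first by rewrite setD11.
  by rewrite setU1K.
rewrite andbC => /andP[/eqP <- _].
by rewrite setD1K ?setU11 // (cardsD1 x (x |: I)) setU11 exprS mulN1r.
Qed.

(** * Acyclic sets of arcs and their sinks *)

Section AcyclicSets.
Variable T : finType.
Implicit Type rho : {set T * T}.

Lemma acyclic_sub rho rho' : rho' \subset rho -> acyclic rho -> acyclic rho'.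
Proof.
move=> /subsetP sub ac s /ac; apply: contra.
by apply: sub_cycle => u v; exact: sub.
Qed.

(** Every vertex of a cycle has an outgoing arc, so a cycle avoids [I] and survives the removal of
    the arcs into [I]. *)
Lemma acyclic_sinks rho (I : {set T}) :
  {in I, forall v w, (v, w) \notin rho} ->
  acyclic [set x in rho | x.2 \notin I] -> acyclic rho.
Proof.
move=> sinkI ac s s0; apply/negP => cyc; have /negP := ac _ s0; apply.
have sI : all [predC I] s.
  apply/allP => v vs; apply/negP => /sinkI /(_ (next s v)) /negP; apply.
  exact: (next_cycle cyc vs).
apply: sub_in_cycle sI cyc => u v /= _ vI uv; rewrite inE uv /=.
exact: vI.
Qed.

(* The sink is an element of [L] from which the fewest vertices are reachable. *)
Lemma acyclic_sink rho (L : {set T}) :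
  acyclic rho -> L != set0 ->
  {in L, forall v w, (v, w) \in rho -> w \in L} ->
  exists2 v, v \in L & forall w, (v, w) \notin rho.
Proof.
move=> ac /set0Pn[x xL] closedL; pose r u v := (u, v) \in rho.
have [v vL vmin] := @arg_minnP _ x (mem L) (fun v => #|connect r v|) xL.
exists v => // w; apply/negP => vw; have /vmin := closedL v vL w vw.
(* Moving along the arc from [v] to [w] loses at least [v] itself: a path from [w] back to [v] would
   close a cycle. *)
rewrite leqNgt => /negP; apply; apply: proper_card; apply/properP; split.
  by apply/subsetP => u; apply: connect_trans; apply: connect1.
exists v; first exact: connect0.
apply/negP => /connectP[p rp vE].
have /negP := ac (w :: p) isT; apply.
by rewrite /= rcons_path rp -vE.
Qed.

End AcyclicSets.

Lemma orientationP (T : finType) (e : rel T) (rho : {set T * T}) :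
  reflect (forall u v, if e u v then ((u, v) \in rho) (+) ((v, u) \in rho)
                       else (u, v) \notin rho)
          (orientation e rho).
Proof.
apply: (iffP forallP) => [h u|h u]; first exact/forallP.
by apply/forallP.
Qed.

Lemma compatibleP (T : finType) (n : nat) (c : {ffun T -> 'I_n})
    (rho : {set T * T}) :
  reflect (forall u w, (u, w) \in rho -> (c u <= c w)%N) (compatible c rho).
Proof.
apply: (iffP forallP) => [h u w|h u]; first by apply/implyP; move/forallP: (h u).
by apply/forallP => w; apply/implyP/h.
Qed.

Lemma proper_coloringP (T : finType) (e : rel T) (n : nat)
    (c : {ffun T -> 'I_n}) :
  reflect (forall u w, e u w -> c u != c w) (proper_coloring e c).
Proof.
apply: (iffP forallP) => [h u w|h u]; first by apply/implyP; move/forallP: (h u).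
by apply/forallP => w; apply/implyP/h.
Qed.

(** * Colorings and orientations of induced subgraphs *)

Section Induced.
Variables (T : finType) (e : rel T).
Hypothesis e_sym : symmetric e.
Variables (lam : T -> nat) (F : fieldType) (t : F).

(** The vertex type remains [T], so that an induction on [W] involves no change of type. *)
Definition induced (W : {set T}) : rel T :=
  [rel u v | [&& e u v, u \in W & v \in W]].

Lemma inducedE W u v : induced W u v = [&& e u v, u \in W & v \in W].
Proof. by []. Qed.

Definition independent (I : {set T}) : bool :=
  [forall u in I, forall v in I, ~~ e u v].

Lemma independentP (I : {set T}) :
  reflect {in I &, forall u v, ~~ e u v} (independent I).
Proof.
apply: (iffP forallP) => [h u v uI vI|h u].
  by have /implyP/(_ uI)/forallP/(_ v)/implyP/(_ vI) := h u.
by apply/implyP => uI; apply/forallP => v; apply/implyP => vI; exact: h.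
Qed.

Definition lamS (I : {set T}) : nat := (\sum_(v in I) lam v)%N.

Lemma lamS_setD (I W : {set T}) : I \subset W ->
  lamS W = (lamS I + lamS (W :\: I))%N.
Proof. by move=> IW; rewrite /lamS (big_setID I) (setIidPr IW). Qed.

Section Colors.
Variable N : nat.
Implicit Types (c : {ffun T -> 'I_N.+1}) (m : 'I_N.+1) (W I : {set T})
  (rho : {set T * T}) (x : {ffun T -> 'I_N.+1} * {set T * T}).

(* A coloring of the induced subgraph on [W] with colors 1, ..., n is a map on
   the whole of [T] taking the value 0 exactly outside [W]. *)
Definition colors W (n : nat) c : bool :=
  [forall v, ((0 < c v)%N == (v \in W)) && (c v <= n)%N].

Lemma colorsP W (n : nat) c :
  reflect (forall v, (0 < c v)%N = (v \in W) /\ (c v <= n)%N) (colors W n c).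
Proof.
apply: (iffP forallP) => [h v|h v]; first by have /andP[/eqP] := h v.
by have [-> ->] := h v; rewrite eqxx.
Qed.

(** Vertices outside the colored set have value 0 and contribute nothing. *)
Definition weight c : nat := (\sum_v lam v * c v)%N.

(** Used with m > 0 to add a color class [I], and with [ord0] to erase it. *)
Definition paint I m c : {ffun T -> 'I_N.+1} :=
  [ffun v => if v \in I then m else c v].

Lemma paintK I m c : {in I, forall v, c v = ord0} ->
  paint I ord0 (paint I m c) = c.
Proof.
move=> h; apply/ffunP => v; rewrite ffunE; case: ifP => [/h //|vI].
by rewrite ffunE vI.
Qed.

Lemma paintK_in0 I m c : paint I ord0 (paint I m c) = c ->
  {in I, forall v, c v = ord0}.
Proof. by move=> <- v vI; rewrite ffunE vI. Qed.

Lemma weight_paint I m c : {in I, forall v, c v = ord0} ->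
  weight (paint I m c) = (m * lamS I + weight c)%N.
Proof.
move=> h; rewrite /weight /lamS (bigID (mem I)).
rewrite [X in _ = (_ + X)%N](bigID (mem I)) /=.
rewrite addnA big_distrr -big_split; congr addn; apply: eq_bigr => v vI.
  by rewrite ffunE vI h //= muln0 addn0 mulnC.
by rewrite ffunE (negbTE vI).
Qed.

(** Painting forgets the values of [c] on [I]; the last conjunct restores them. *)
Lemma colors_paint W I n m c : I \subset W -> (0 < m <= n)%N ->
  colors (W :\: I) n c = colors W n (paint I m c) && [forall v in I, c v == ord0].
Proof.
move=> /subsetP IW /andP[m0 mn].
apply/colorsP/andP => [h|[/colorsP h /forall_inP h0] v].
  split; last first.
    apply/forall_inP => v vI; have [] := h v; rewrite inE vI /= lt0n => /negbFE.
    by move=> c0 _; exact: c0.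
  apply/colorsP => v; rewrite ffunE; have [] := h v; rewrite inE.
  by case: ifP => [/IW ->|].
have := h v; rewrite ffunE inE; case: ifP => //= vI _.
by rewrite (eqP (h0 v vI)).
Qed.

(** This is chi_W(n) with [t] for q. The bound [N] fixes one type of colorings for all n <= N. *)
Definition proper_sum W (n : nat) : F :=
  \sum_(c | colors W n c && proper_coloring (induced W) c) t ^+ weight c.

Definition compatible_acyclic W (n : nat) x : bool :=
  [&& colors W n x.1, acyclic_orientation (induced W) x.2 & compatible x.1 x.2].

(** This is R_W(n) with [t] for q. *)
Definition orientation_sum W (n : nat) : F :=
  \sum_(x | compatible_acyclic W n x) t ^+ weight x.1.

Lemma colors0 W c : colors W 0 c = (W == set0) && (c == [ffun => ord0]).
Proof.
apply/colorsP/andP => [h|[/eqP -> /eqP ->] v]; last by rewrite ffunE inE.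
have c0 v : c v = ord0 by apply/val_inj/eqP; rewrite -leqn0; case: (h v).
split; last by apply/eqP/ffunP => v; rewrite ffunE.
by apply/eqP/setP => v; rewrite inE; have [<- _] := h v; rewrite c0.
Qed.

Lemma weight0 : weight [ffun => ord0] = 0%N.
Proof. by rewrite /weight big1 // => v _; rewrite ffunE muln0. Qed.

Lemma proper_sum0 W : proper_sum W 0 = (W == set0)%:R.
Proof.
rewrite /proper_sum; under eq_bigl do rewrite colors0.
have [->|_] := eqVneq W set0; last by rewrite big_pred0.
rewrite (big_pred1 [ffun => ord0]) ?weight0 // => c /=.
have [->|] //= := eqVneq c; apply/proper_coloringP => u w /and3P[_].
by rewrite inE.
Qed.

Lemma orientation_sum0 W : orientation_sum W 0 = (W == set0)%:R.
Proof.
rewrite /orientation_sum /compatible_acyclic.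
under eq_bigl do rewrite colors0.
have [->|_] := eqVneq W set0; last by rewrite big_pred0.
rewrite (big_pred1 ([ffun => ord0], set0)) ?weight0 // => -[c rho] /=.
rewrite xpair_eqE; congr (_ && _).
apply/andP/eqP => [[/andP[/orientationP h _] _]|->].
  by apply/setP => -[u v]; have := h u v;
     rewrite inducedE !in_set0 !andbF => /negbTE.
split; last by apply/compatibleP => u w; rewrite inE.
apply/andP; split.
  by apply/orientationP => u v; rewrite inducedE !in_set0 !andbF.
apply/asboolP => -[//|v [|w s]] _; by rewrite /= inE.
Qed.

(** Colorings are grouped by the class [I] of color n+1, independent by properness; erasing [I]
    leaves a proper coloring of [W :\: I] with n colors, and painting [I] is the inverse. *)
Lemma proper_sumS W (n : nat) : (n < N)%N ->
  proper_sum W n.+1 =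
    \sum_(I : {set T} | (I \subset W) && independent I)
      t ^+ (n.+1 * lamS I) * proper_sum (W :\: I) n.
Proof.
move=> nN; pose m : 'I_N.+1 := inord n.+1.
have mE : m = n.+1 :> nat by rewrite inordK.
rewrite /proper_sum (partition_big (fun c => [set v | c v == m])
  (fun I => (I \subset W) && independent I)) /=; last first.
  move=> c /andP[/colorsP h /proper_coloringP pc]; apply/andP; split.
    apply/subsetP => v; rewrite inE => /eqP cv; have [<- _] := h v.
    by rewrite cv mE.
  apply/independentP => u v; rewrite !inE => /eqP cu /eqP cv; apply/negP => uv.
  suff: c u != c v by rewrite cu cv eqxx.
  by apply: pc; rewrite inducedE uv -(proj1 (h u)) -(proj1 (h v)) cu cv mE.
apply: eq_bigr => I /andP[IW /independentP indI].
rewrite big_distrr (reindex_onto (paint I m) (paint I ord0)) /=; last first.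
  move=> c /andP[_ /eqP <-]; apply/ffunP => v; rewrite ffunE inE.
  by case: ifP => [/eqP //|]; rewrite ffunE inE => ->.
apply: eq_big => [c|c /andP[_ /eqP /paintK_in0 c0]]; last first.
  by rewrite weight_paint // mE exprD.
apply/andP/andP.
  move=> [/andP[/andP[/colorsP h /proper_coloringP pc] /eqP lvl]].
  move=> /eqP /paintK_in0 c0.
  have cI v : (v \in I) = false -> c v != m.
    by move=> vI; move/setP/(_ v): lvl; rewrite inE ffunE vI => ->.
  split.
    apply/colorsP => v; rewrite inE; have := h v; rewrite ffunE.
    case: ifP => [/c0 -> //|/= /cI]; rewrite -val_eqE /= mE => cm [-> cn].
    by split=> //; rewrite -ltnS ltn_neqAle cm.
  apply/proper_coloringP => u w /and3P[uw].
  rewrite !inE => /andP[uI uW] /andP[wI wW].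
  have := pc u w; rewrite inducedE uw uW wW !ffunE (negbTE uI) (negbTE wI); exact.
move=> [/colorsP h /proper_coloringP pc].
have c0 : {in I, forall v, c v = ord0}.
  move=> v vI; have [] := h v; rewrite inE vI lt0n => /negbFE/eqP c0 _.
  exact/val_inj.
have cm v : (c v == m) = false.
  by apply/eqP => cv; have [_] := h v; rewrite cv mE ltnn.
split; last by rewrite paintK.
apply/andP; split; last first.
  by apply/eqP/setP => v; rewrite inE ffunE; case: ifP; rewrite ?eqxx ?cm.
apply/andP; split.
  apply/colorsP => v; have := h v; rewrite ffunE inE.
  case: ifP => [vI _|vI /= [-> cn]]; first by rewrite mE (subsetP IW).
  by split=> //; apply: ltnW.
apply/proper_coloringP => u w /and3P[uw uW wW]; rewrite !ffunE.
case: ifP => uI; case: ifP => wI.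
- by rewrite (negbTE (indI u w uI wI)) in uw.
- by rewrite eq_sym cm.
- by rewrite cm.
- by apply: pc; rewrite inducedE uw !inE uI wI uW wW.
Qed.

(** Vertices outside [W] have no outgoing arc either; for m > 0 their color 0 keeps them out. *)
Definition top_sinks x m : {set T} :=
  [set v | (x.1 v == m) && [forall w, (v, w) \notin x.2]].

Lemma top_sinksP x m v :
  reflect (x.1 v = m /\ forall w, (v, w) \notin x.2) (v \in top_sinks x m).
Proof.
rewrite inE; apply: (iffP andP) => -[]; first by move=> /eqP-> /forallP.
by move=> -> h; split=> //; apply/forallP.
Qed.

Lemma edge_in_orientation W rho u v :
  orientation (induced W) rho -> (u, v) \in rho -> induced W u v.
Proof.
by move=> /orientationP/(_ u v); case: ifP => // _ /negbTE ->.
Qed.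

(** An edge between two sinks would have to leave one of them. *)
Lemma top_sinks_independent W (n : nat) x m : (0 < m)%N ->
  compatible_acyclic W n x ->
  (top_sinks x m \subset W) && independent (top_sinks x m).
Proof.
move=> m0 /and3P[/colorsP h /andP[/orientationP o _] _].
have sW v : v \in top_sinks x m -> v \in W.
  by move=> /top_sinksP[cv _]; have [<- _] := h v; rewrite cv.
apply/andP; split; first exact/subsetP.
apply/independentP => u v uS vS; apply/negP => uv; have := o u v.
rewrite inducedE uv !sW //=; have /top_sinksP[_ /(_ v) /negbTE ->] := uS.
by have /top_sinksP[_ /(_ u) /negbTE ->] := vS.
Qed.

(** Colors do not decrease along arcs and n+1 is the largest, so the vertices of color n+1 are
    closed under arcs; if there are any, one of them is a sink. *)
Lemma top_sinks_eq0 W (n : nat) x m : m = n.+1 :> nat ->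
  compatible_acyclic W n.+1 x ->
  (top_sinks x m == set0) = colors W n x.1.
Proof.
move=> mE /and3P[/colorsP h /andP[_ /asboolP ac] /compatibleP cmp].
apply/eqP/colorsP => [top0 v|h']; last first.
  apply/setP => v; rewrite [RHS]inE; apply/top_sinksP => -[cv _].
  by have [_] := h' v; rewrite cv mE ltnn.
have [-> cn] := h v; split=> //; rewrite -ltnS ltn_neqAle cn andbT.
apply/negP => /eqP cv.
have L0 : [set u | x.1 u == m] != set0.
  by apply/set0Pn; exists v; rewrite inE -val_eqE /= cv mE.
have [|u uL us] := acyclic_sink ac L0.
  move=> u; rewrite inE => /eqP cu w /cmp; rewrite cu mE inE -val_eqE /= => cw.
  by rewrite mE eqn_leq cw andbT; have [] := h w.
suff : u \in top_sinks x m by rewrite top0 inE.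
by apply/top_sinksP; split=> //; apply/eqP; rewrite inE in uL.
Qed.

(** The orientation of the edges meeting [I] that is forced once the vertices of the independent set
    [I] are sinks. *)
Definition arcs_into W I : {set T * T} :=
  [set y | induced W y.1 y.2 && (y.2 \in I)].

(** Pairs on [W :\: I] correspond to pairs on [W] having [I] among their sinks of color n+1: paint
    [I] and direct all its edges into it. The final round-trip equation is the side condition of
    [reindex_onto]. Color n+1 remains allowed outside [I]. *)
Lemma compatible_acyclic_paint W I (n : nat) x m :
  I \subset W -> independent I -> m = n.+1 :> nat ->
  compatible_acyclic (W :\: I) n.+1 x =
  [&& compatible_acyclic W n.+1 (paint I m x.1, x.2 :|: arcs_into W I),
      I \subset top_sinks (paint I m x.1, x.2 :|: arcs_into W I) m
    & (paint I ord0 (paint I m x.1),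
       (x.2 :|: arcs_into W I) :\: arcs_into W I) == x].
Proof.
case: x => c rho IW indI mE; rewrite /compatible_acyclic xpair_eqE /=.
have sIW := subsetP IW; move/independentP: indI => indI.
have arcsE u v : ((u, v) \in arcs_into W I) = induced W u v && (v \in I).
  by rewrite inE.
apply/idP/idP.
  move=> /and3P[col /andP[o /asboolP ac] /compatibleP cmp].
  have := col; rewrite (@colors_paint W I n.+1 m) ?mE ?leqnn //.
  move=> /andP[col' /forall_inP c0].
  have {}c0 : {in I, forall v, c v = ord0} by move=> v /c0/eqP.
  have rhoI u v : (u, v) \in rho ->
      [/\ e u v, u \in W, v \in W, u \notin I & v \notin I].
    move=> /(edge_in_orientation o) /and3P[uv].
    by rewrite !inE => /andP[-> ->] /andP[-> ->].
  have sinkI : {in I, forall v w, (v, w) \notin rho :|: arcs_into W I}.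
    move=> v vI w; rewrite inE arcsE negb_or; apply/andP; split.
      by apply/negP => /rhoI[_ _ _]; rewrite vI.
    by apply/negP => /andP[/and3P[vw _ _] wI]; have := indI v w vI wI; rewrite vw.
  rewrite col' paintK // eqxx /=.
  apply/andP; split; [apply/andP; split|apply/andP; split].
  - apply/andP; split.
      apply/orientationP => u v; have := elimT (orientationP _ _) o u v.
      rewrite !(in_setU, arcsE, inducedE, in_setD) [e u v]e_sym.
      case vu: (e v u) => /=; last by rewrite orbF.
      case uW: (u \in W); last by rewrite !andbF /= orbF.
      case vW: (v \in W); last by rewrite !andbF /= orbF.
      case uI: (u \in I); case vI: (v \in I) => //=; rewrite ?orbF ?orbT //.
      + by have := indI v u vI uI; rewrite vu.
      + by move=> /negbTE ->.
      + by move=> _; apply/negP => /rhoI[_ _ _]; rewrite vI.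
    (* No cycle is created: without the arcs into the sinks [I], only arcs of [rho] remain. *)
    apply/asboolP/(acyclic_sinks sinkI); apply: acyclic_sub ac.
    by apply/subsetP => -[u v]; rewrite !inE => /andP[/orP[//|/andP[_ ->]]].
  (* A new arc ends at color n+1, which bounds all the others. *)
  - apply/compatibleP => u w; rewrite inE arcsE !ffunE => /orP[uw|/andP[_ ->]].
      by have [_ _ _ /negbTE -> /negbTE ->] := rhoI u w uw; exact: cmp.
    case: ifP => // _; rewrite mE; have := elimT (colorsP _ _ _) col u; by case.
  - apply/subsetP => v vI; apply/top_sinksP; split; first by rewrite ffunE vI.
    exact: sinkI.
  - apply/eqP/setP => -[u v]; rewrite in_setD in_setU arcsE.
    case: ((u, v) \in rho) / boolP => [/rhoI[_ _ _ _ /negbTE ->]|_].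
      by rewrite andbF.
    by rewrite andNb.
move=> /and3P[/and3P[col /andP[/orientationP o /asboolP ac] /compatibleP cmp]].
move=> /subsetP sinkI /andP[/eqP/paintK_in0 c0 /eqP rhoE].
have sink v w : v \in I -> (v, w) \notin rho :|: arcs_into W I.
  by move=> /sinkI/top_sinksP[].
(* Tails avoid [I] because its vertices are sinks, heads because the round trip leaves no arc into
   [I] in [rho]. *)
have rhoI u v : (u, v) \in rho -> [/\ induced W u v, u \notin I & v \notin I].
  move=> uv; have uvW : induced W u v.
    by have := o u v; case: ifP => // _; rewrite inE uv.
  split=> //; first by apply/negP => /(sink u v); rewrite inE uv.
  by move: uv; rewrite -rhoE in_setD arcsE uvW => /andP[].
apply/and3P; split.
- rewrite (@colors_paint W I n.+1 m) ?mE ?leqnn // col.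
  by apply/forall_inP => v /c0 ->.
- apply/andP; split; last first.
    by apply/asboolP; apply: acyclic_sub ac; apply: subsetUl.
  apply/orientationP => u v; have := o u v; rewrite !(in_setU, arcsE).
  case: ((u, v) \in rho) / boolP => [/rhoI[uvW uI vI]|uv].
    rewrite uvW; move: uvW; rewrite !inducedE !in_setD uI vI (negbTE uI).
    by rewrite andbF orbF => ->.
  rewrite !inducedE !in_setD; case: (e u v) => //=.
  case: (boolP (u \in I)) => uI //=;
    case: (boolP (v \in I)) => vI //=; rewrite ?andbF //.
  by case: ifP => // _; rewrite orbF.
apply/compatibleP => u w uw; have [_ /negbTE uI /negbTE wI] := rhoI u w uw.
by have := cmp u w; rewrite inE uw !ffunE uI wI; apply.
Qed.

Lemma orientation_sumS W (n : nat) : (n < N)%N ->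
  orientation_sum W n =
    \sum_(I : {set T} | (I \subset W) && independent I)
      (-1) ^+ #|I| * (t ^+ (n.+1 * lamS I) * orientation_sum (W :\: I) n.+1).
Proof.
move=> nN; pose m : 'I_N.+1 := inord n.+1.
have mE : m = n.+1 :> nat by rewrite inordK.
transitivity (\sum_(I : {set T} | (I \subset W) && independent I)
  \sum_(x | compatible_acyclic W n.+1 x && (I \subset top_sinks x m))
    (-1) ^+ #|I| * t ^+ weight x.1); last first.
  apply: eq_bigr => I /andP[IW indI]; rewrite -big_distrr; congr (_ * _).
  rewrite /orientation_sum big_distrr.
  rewrite (reindex_onto
    (fun x => (paint I m x.1, x.2 :|: arcs_into W I))
    (fun x => (paint I ord0 x.1, x.2 :\: arcs_into W I))) /=; last first.
    move=> [c rho] /= /andP[/and3P[_ /andP[/orientationP o _] _] /subsetP sI].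
    congr pair.
      apply/ffunP => v; rewrite !ffunE; have [vI|//] := boolP (v \in I).
      by have /top_sinksP[] := sI v vI.
    (* Restoring the erased arcs is harmless: an edge ending at a sink in [I] is already directed
       into it. *)
    apply/setP => -[u v]; rewrite in_setU in_setD.
    have [|_] := boolP ((u, v) \in _); last by rewrite orbF.
    rewrite inE /= => /andP[uv vI].
    have /top_sinksP[_ /(_ u)/negbTE /= vu] := sI v vI.
    by have /= := o u v; rewrite uv vu addbF => ->.
  apply: eq_big => [x|x].
    by rewrite (@compatible_acyclic_paint W I n x m) // andbA.
  case/andP=> _; case: x => c rho; rewrite xpair_eqE.
  move=> /andP[/eqP/paintK_in0 c0 _].
  by rewrite weight_paint // mE exprD.
rewrite (exchange_big_dep (compatible_acyclic W n.+1)) /=; last first.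
  by move=> I x _ /andP[].
rewrite /orientation_sum big_mkcond [RHS]big_mkcond; apply: eq_bigr => x _.
have [ca|nca] := boolP (compatible_acyclic W n.+1 x); last first.
  case: ifP => // /and3P[/colorsP col o cmp]; case/and3P: nca; split=> //.
  by apply/colorsP => v; have [-> cn] := col v; split=> //; apply: leqW.
have m0 : (0 < m)%N by rewrite mE.
have /andP[SW /independentP indS] := top_sinks_independent m0 ca.
(* Any set of such sinks lies in [W] and is independent, so these constraints drop out. *)
rewrite (eq_bigl (fun I : {set T} => I \subset top_sinks x m));
    last first => [I|].
  apply/andP/idP => [[]//|IS]; split=> //.
  apply/andP; split; first exact: subset_trans SW.
  by apply/independentP => u v /(subsetP IS) uS /(subsetP IS); apply: indS.
rewrite -big_distrl /= sum_subset_sign (top_sinks_eq0 mE ca) /compatible_acyclic.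
by case/and3P: ca => _ -> ->; case: colors; rewrite ?mul1r ?mul0r.
Qed.

End Colors.
End Induced.

(** * The interpolating polynomial and its image under q |-> 1/q *)

Section Interpolation.
Variables (T : finType) (e : rel T).
Hypothesis e_sym : symmetric e.
Variable lam : T -> nat.
Hypothesis lam_gt0 : forall v, (0 < lam v)%N.
Variables (F : fieldType) (s : {rmorphism F -> F}) (t : F).
Hypotheses (t_neq0 : t != 0) (tX_neq1 : forall n, (0 < n)%N -> 1 - t ^+ n != 0)
  (st : s t = t^-1).

Lemma lamS_gt0 (I : {set T}) : I != set0 -> (0 < lamS lam I)%N.
Proof.
by case/set0Pn=> v vI; rewrite /lamS (bigD1 v) //= addn_gt0 lam_gt0.
Qed.

Lemma lamS0 : lamS lam set0 = 0%N.
Proof. by rewrite /lamS big_set0. Qed.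

(** Strong induction on |W|. Both recursions express the increment from n to n+1 through the proper
    subsets [W :\: I], and [sum_horner_expr] sums these increments. [P] is chosen before [N], hence
    serves all bounds. *)
Lemma interpolation (W : {set T}) :
  exists P : {poly F}, forall N n : nat, (n <= N)%N ->
    P.[t ^+ n] = proper_sum e lam t N W n /\
    (map_poly s P).[t ^+ n]
      = (-1) ^+ #|W| / t ^+ lamS lam W * orientation_sum e lam t N W n.
Proof.
have [k] := ubnP #|W|; elim: k W => // k IH W Wk.
pose nice (I : {set T}) := [&& I \subset W, independent e I & I != set0].
have /fin_all_exists[P PE] : forall I : {set T}, exists P : {poly F}, nice I ->
    forall N n : nat, (n <= N)%N ->
    P.[t ^+ n] = proper_sum e lam t N (W :\: I) n /\
    (map_poly s P).[t ^+ n]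
      = (-1) ^+ #|W :\: I| / t ^+ lamS lam (W :\: I)
        * orientation_sum e lam t N (W :\: I) n.
  move=> I; have [/and3P[IW _ I0]|nI] := boolP (nice I); last by exists 0.
  have [|P PE] := IH (W :\: I); last by exists P.
  rewrite -ltnS; apply: leq_trans Wk; rewrite ltnS.
  rewrite -(cardsID I W) (setIidPr IW) -[X in (X < _)%N]add0n.
  by rewrite ltn_add2r card_gt0.
(* h(t^(n+1)) is to be chi_W(n+1) - chi_W(n). Replacing X by X/t lowers the argument t^(n+1) to t^n;
   its image under [s], X replaced by tX, raises t^n to t^(n+1), as the recursion for R_W
   requires. *)
pose h := \sum_(I | nice I) 'X^(lamS lam I) * (P I \Po (t^-1 *: 'X)).
(* Positivity of [lam] makes every power of X in [h] positive. *)
have h0 : h.[0] = 0.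
  rewrite horner_sum big1 // => I /and3P[_ _ /lamS_gt0 l0].
  by rewrite hornerM hornerXn expr0n -[_ == _]negbK -lt0n l0 mul0r.
have hq m : h.[t ^+ m.+1]
    = \sum_(I | nice I) t ^+ (m.+1 * lamS lam I) * (P I).[t ^+ m].
  rewrite horner_sum; apply: eq_bigr => I _.
  rewrite hornerM hornerXn horner_comp hornerZ hornerX exprS mulKf //.
  by rewrite -exprS -exprM.
have hqV m : (map_poly s h).[t ^+ m]
    = \sum_(I | nice I) t ^+ (m * lamS lam I) * (map_poly s (P I)).[t ^+ m.+1].
  rewrite rmorph_sum horner_sum; apply: eq_bigr => I _ /=.
  rewrite rmorphM /= map_comp_poly map_polyZ /= map_polyX map_polyXn.
  rewrite fmorphV /= st invrK.
  by rewrite hornerM hornerXn horner_comp hornerZ hornerX -exprS -exprM.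
have splitI (G : {set T} -> F) :
    \sum_(I : {set T} | (I \subset W) && independent e I) G I
    = G set0 + \sum_(I | nice I) G I.
  rewrite (bigD1 set0) /=; last first.
    by rewrite sub0set; apply/independentP => u v; rewrite inE.
  by congr (_ + _); apply: eq_bigl => I; rewrite /nice andbA.
have [P0 P0E] := sum_horner_expr t_neq0 tX_neq1 st h0.
(* [P0] vanishes at t^0, so the added constant is the common value of both sums at n = 0. *)
exists (P0 + ((W == set0)%:R)%:P) => N n nN; have [P0n P0Vn] := P0E n.
rewrite rmorphD /= map_polyC /= !hornerD !hornerC rmorph_nat.
rewrite P0n P0Vn {P0n P0Vn}.
split.
  elim: n nN => [|n IHn] nN; first by rewrite big_ord0 add0r proper_sum0.
  rewrite big_ord_recr /= addrAC IHn 1?ltnW // proper_sumS // splitI.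
  rewrite lamS0 muln0 mul1r setD0 hq; congr (_ + _).
  by apply: eq_bigr => I /PE/(_ N n (ltnW nN))[->].
elim: n nN => [|n IHn] nN.
  rewrite big_ord0 oppr0 add0r orientation_sum0.
  have [->|_] := eqVneq; last by rewrite mulr0.
  by rewrite cards0 lamS0 divr1 mulr1.
rewrite big_ord_recr /= opprD addrAC IHn 1?ltnW // orientation_sumS // splitI.
rewrite cards0 lamS0 muln0 !mul1r setD0 mulrDr -[RHS]addr0 -addrA; congr (_ + _).
apply/eqP; rewrite subr_eq0 hqV mulr_sumr; apply/eqP/eq_bigr => I nI.
have [_ ->] := PE I nI N n.+1 nN; have /and3P[IW _ _] := nI.
rewrite (lamS_setD lam IW) exprD mulSn exprD.
rewrite -[#|W|](cardsID I) (setIidPr IW) exprD.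
rewrite !mulrA; congr (_ * _); rewrite invfM.
(* The two signs (-1)^|I| cancel, and so does t^lam(I) against its inverse. *)
have x1 :
    (-1) ^+ #|I| * (-1) ^+ #|I| * ((t ^+ lamS lam I)^-1 * t ^+ lamS lam I) = 1.
  by rewrite -expr2 sqrr_sign mulVf ?mulr1 // expf_neq0.
by rewrite -[RHS]mul1r -[X in _ = X * _]x1; ring.
Qed.

End Interpolation.

Lemma induced_setT (T : finType) (e : rel T) : induced e [set: T] = e.
Proof. by apply/funext => u; apply/funext => v; rewrite inducedE !inE !andbT. Qed.

(** * From colors in 1, ..., n to the elements of ['I_n] *)

Section Shift.
Variables (T : finType) (n : nat).
Implicit Type c : {ffun T -> 'I_n.+1}.

(** In [colors] the value 0 is reserved for uncolored vertices, whereas in [chi] the index 0 stands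
    for color 1. *)
Definition shift_color c : {ffun T -> 'I_n.+2} := [ffun v => lift ord0 (c v)].
Definition unshift_color (c : {ffun T -> 'I_n.+2}) : {ffun T -> 'I_n.+1} :=
  [ffun v => inord (c v).-1].

Lemma shift_colorE c v : shift_color c v = (c v).+1 :> nat.
Proof. by rewrite ffunE lift0. Qed.

Lemma shift_colorK : cancel shift_color unshift_color.
Proof.
by move=> c; apply/ffunP => v; rewrite ffunE shift_colorE inord_val.
Qed.

Lemma unshift_colorK (c : {ffun T -> 'I_n.+2}) :
  colors [set: T] n.+1 c -> shift_color (unshift_color c) = c.
Proof.
move=> /colorsP h; apply/ffunP => v; apply/val_inj; rewrite /= shift_colorE ffunE.
have [] := h v; rewrite inE => c0 cn; rewrite inordK ?prednK //.
Qed.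

Lemma shift_colors c : colors [set: T] n.+1 (shift_color c).
Proof. by apply/colorsP => v; rewrite shift_colorE inE. Qed.

Lemma weight_shift_color (lam : T -> nat) c :
  weight lam (shift_color c) = color_weight lam c.
Proof. by apply: eq_bigr => v _; rewrite shift_colorE. Qed.

End Shift.

Lemma chi_proper_sum (T : finType) (e : rel T) (lam : T -> nat) (n : nat) :
  (0 < n)%N -> chi e lam n = proper_sum e lam q n [set: T] n.
Proof.
case: n => // n _; rewrite /proper_sum.
rewrite (reindex_onto (@shift_color T n) (@unshift_color T n)).
  apply: eq_big => [c|c _]; last by rewrite weight_shift_color.
  rewrite shift_colorK eqxx andbT shift_colors induced_setT.
  apply/proper_coloringP/proper_coloringP => h u w /h;
    by rewrite -!val_eqE /= !shift_colorE eqSS.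
by move=> c /andP[/unshift_colorK].
Qed.

Lemma compatible_shift_color (T : finType) (n : nat) (c : {ffun T -> 'I_n.+1})
    (rho : {set T * T}) : compatible (shift_color c) rho = compatible c rho.
Proof.
by apply/compatibleP/compatibleP => h u w /h; rewrite !shift_colorE.
Qed.

Lemma orientation_sum_setT (T : finType) (e : rel T) (lam : T -> nat) (n : nat) :
  (0 < n)%N -> orientation_sum e lam q n [set: T] n =
    \sum_(x : {ffun T -> 'I_n} * {set T * T}
          | acyclic_orientation e x.2 && compatible x.1 x.2)
      q ^+ color_weight lam x.1.
Proof.
case: n => // n _; rewrite /orientation_sum.
rewrite (reindex_onto (fun x => (@shift_color T n x.1, x.2))
                      (fun x => (@unshift_color T n x.1, x.2))) /=; last first.
  by move=> [c rho] /and3P[/unshift_colorK /= ->].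
apply: eq_big => [[c rho]|x _]; last by rewrite weight_shift_color.
rewrite /compatible_acyclic /= shift_colorK eqxx andbT shift_colors induced_setT.
by rewrite compatible_shift_color.
Qed.

(** * The change of variable x = [n]_q and evaluation at [-n]_{1/q} *)

Section QIntegerCoordinate.
Variables (F : fieldType) (t : F).

(** The affine map taking [n]_t back to t^n. *)
Definition qint_coordinate : {poly F} := 1 - (1 - t) *: 'X.

Lemma horner_qint_coordinate (P : {poly F}) (u : F) : 1 - t != 0 ->
  (P \Po qint_coordinate).[(1 - u) / (1 - t)] = P.[u].
Proof.
move=> t1; rewrite horner_comp hornerD hornerN hornerZ hornerX hornerC.
by rewrite mulrCA divff // mulr1 opprB addrC subrK.
Qed.

End QIntegerCoordinate.

Lemma map_qint_coordinate (F : fieldType) (s : {rmorphism F -> F}) (t : F)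
    (P : {poly F}) :
  map_poly s (P \Po qint_coordinate t)
  = map_poly s P \Po qint_coordinate (s t).
Proof.
rewrite map_comp_poly /qint_coordinate rmorphB rmorph1 /= map_polyZ /=.
by rewrite map_polyX rmorphB rmorph1.
Qed.

Lemma signed_scaleK (F : fieldType) (k : nat) (b x : F) : b != 0 ->
  (-1) ^+ k * b * ((-1) ^+ k / b * x) = x.
Proof.
by move=> b0; rewrite mulrA mulrACA -expr2 sqrr_sign mul1r divff // mul1r.
Qed.

Theorem theorem18 (T : finType) (e : rel T) (e_sym : symmetric e)
    (e_irr : irreflexive e) (lam : T -> nat)
    (lam_gt0 : forall v : T, (0 < lam v)%N) (n : nat) (n_gt0 : (0 < n)%N) :
  (-1) ^+ #|T| * q ^+ (\sum_v lam v)%N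
    * (map_poly subst_qV (chi_tilde e lam)).[qint q^-1 (- n%:Z)]
  = \sum_(x : {ffun T -> 'I_n} * {set T * T}
          | acyclic_orientation e x.2 && compatible x.1 x.2)
      q ^+ color_weight lam x.1.
Proof.
have [P PE] := interpolation e_sym lam_gt0 q_neq0 q_expn_neq1 subst_qV_q [set: T].
have q1 : 1 - q != 0 by have := @q_expn_neq1 1 isT.
have qV1 : 1 - q^-1 != 0.
  by rewrite subr_eq0 eq_sym invr_eq1 eq_sym -subr_eq0.
have chiP : is_chi_tilde e lam (P \Po qint_coordinate q).
  move=> k k0; have [Pk _] := PE k k (leqnn k).
  rewrite (chi_proper_sum e lam k0) -Pk.
  exact: (horner_qint_coordinate P (q ^+ k) q1).
have -> : chi_tilde e lam = P \Po qint_coordinate q.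
  apply: (is_chi_tilde_inj _ chiP).
  (* The description is not at its default value, since [chiP] exhibits a solution. *)
  apply: (@classical_sets.xgetPex _ 0 (is_chi_tilde e lam)).
  by exists (P \Po qint_coordinate q); exact: chiP.
rewrite map_qint_coordinate /= subst_qV_q horner_qint_coordinate //.
(* In base 1/q the coordinate of [-n] is again q^n, the point where [interpolation] gives the value
   of the image. *)
have -> : q^-1 ^ (- n%:Z) = q ^+ n by rewrite exprz_inv opprK.
have [_ ->] := PE n n (leqnn n).
rewrite orientation_sum_setT // cardsT.
have -> : lamS lam [set: T] = (\sum_v lam v)%N.
  by apply: eq_bigl => v; rewrite inE.
exact: signed_scaleK (expf_neq0 _ q_neq0).
Qed.
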